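(* Let $G=(V,E)$ be a finite simple graph with at least one edge, of order $n$ and with degree sequence $\delta_1\ge\delta_2\ge\cdots\ge\delta_n$, and let $\mathcal{L}(G)$ be its line graph. For each $v\in V$ with $\delta(v)=\delta_1$ let $\delta_v=\max\{\delta(u): u\sim v\}$, and let $\delta_*=\min\{\delta_v: v\in V,\ \delta(v)=\delta_1\}$. (i) For every integer $k\in\{2-\delta_*-\delta_1,\dots,\delta_1-\delta_*\}$ such that $\mathcal{L}(G)$ contains a defensive $k$-alliance, $$a_k(\mathcal{L}(G))\le\left\lceil\frac{\delta_1+\delta_*+k}{2}\right\rceil .$$ (ii) For every integer $k\in\{2-\delta_1-\delta_2,\dots,\delta_1+\delta_2-2\}$ such that $\mathcal{L}(G)$ contains a defensive $k$-alliance, $$\left\lceil\frac{\delta_n+\delta_{n-1}+k}{2}\right\rceil\le a_k(\mathcal{L}(G)).$$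
   Context: $\delta(v)$ denotes the degree of $v$ in $G$ and $u\sim v$ means $u$ and $v$ are adjacent. The line graph $\mathcal{L}(G)$ has the edges of $G$ as vertices, two being adjacent when they are distinct edges sharing an endpoint. For a graph $H$ with vertex set $W$, a set $X\subseteq W$ and $w\in W$, $\delta_X(w)$ denotes the number of neighbors of $w$ in $X$, and $\bar S=W\setminus S$. For an integer $k$, a nonempty set $S\subseteq W$ is a defensive $k$-alliance in $H$ if $\delta_S(w)\ge \delta_{\bar S}(w)+k$ for every $w\in S$. The defensive $k$-alliance number $a_k(H)$ is the minimum cardinality of a defensive $k$-alliance in $H$; in particular $a_k(H)=1$ whenever $k\le-\delta$, where $\delta$ is the minimum degree of $H$. *)

(* Defs.v *)
From mathcomp Require Import all_boot all_order all_algebra.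
Set Implicit Arguments.
Unset Strict Implicit.
Unset Printing Implicit Defensive.
Import Order.TTheory GRing.Theory Num.Theory.

Record sgraph := SGraph {
  vertex :> finType;
  adj : rel vertex;
  adj_sym : symmetric adj;
  adj_irr : irreflexive adj }.

Section Degrees.
Variable G : sgraph.
Implicit Types (u v w : G) (X : {set G}).

Definition degree_in X w : nat := #|[set u in X | adj w u]|.
Definition degree w : nat := degree_in [set: G] w.

Definition degree_seq : seq nat := sort geq [seq degree v | v <- enum G].

(* The index is 1-based: delta 1 is the maximum degree and delta #|G| the
   minimum degree. Indices outside 1, ..., #|G| give junk values. *)
Definition delta (i : nat) : nat := nth 0 degree_seq i.-1.

Definition max_nbr_degree v : nat := \max_(u | adj v u) degree u.

(* The neutral element #|G| exceeds every degree, so it does not affect the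
   minimum, which ranges over a nonempty set as soon as G has a vertex. *)
Definition delta_star : nat :=
  \big[minn/#|G|]_(v | degree v == delta 1) max_nbr_degree v.

Definition edges : {set {set G}} := [set [set p.1; p.2] | p : G * G & adj p.1 p.2].

End Degrees.

Section LineGraph.
Variable G : sgraph.

Definition line_vertex : finType := {x : {set G} | x \in edges G}.

Definition line_adj : rel line_vertex :=
  fun x y => (x != y) && (val x :&: val y != set0).

Lemma line_adj_sym : symmetric line_adj.
Proof. by move=> x y; rewrite /line_adj eq_sym setIC. Qed.

Lemma line_adj_irr : irreflexive line_adj.
Proof. by move=> x; rewrite /line_adj eqxx. Qed.

Definition line_graph : sgraph := SGraph line_adj_sym line_adj_irr.

End LineGraph.

Section Alliances.
Variables (H : sgraph) (k : int).

Definition defensive_alliance (S : {set H}) : bool :=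
  (S != set0) &&
  [forall w in S, ((degree_in (~: S) w)%:Z + k <= (degree_in S w)%:Z)%R].

(* Meaningful only if H contains a defensive k-alliance: the neutral element
   #|H| bounds every cardinality, and is the junk value otherwise. *)
Definition alliance_number : nat :=
  \big[minn/#|H|]_(S : {set H} | defensive_alliance S) #|S|.

Lemma alliance_number_le (S : {set H}) :
  defensive_alliance S -> alliance_number <= #|S|.
Proof. by move=> dS; rewrite /alliance_number -minEnat -leEnat; apply: bigmin_le_cond. Qed.

Lemma alliance_number_attained :
  (exists S, defensive_alliance S) ->
  exists2 S, defensive_alliance S & alliance_number = #|S|.
Proof.
case=> S0 dS0; case: (arg_minnP (fun S : {set H} => #|S|) dS0) => S dS minS.
exists S => //; apply/eqP; rewrite eqn_leq alliance_number_le //=.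
rewrite /alliance_number; elim/big_ind: _ => //; first exact: max_card.
by move=> m n leSm leSn; rewrite leq_min leSm.
Qed.

End Alliances.

(* Main.v *)
Require Import Defs.
From mathcomp Require Import all_boot all_order all_algebra.
From mathcomp Require Import zify lra.
Set Implicit Arguments.
Unset Strict Implicit.
Unset Printing Implicit Defensive.
Import Order.TTheory GRing.Theory Num.Theory.

(** Write [d] for the degree in [G]. Since the degrees inside and outside [S]
    add up to the full degree, [S] is a defensive k-alliance of a graph iff
    [deg w + k <= 2 deg_S w] for all [w] in [S] ([defensive_allianceP]). The
    line graph enters only through the stars of [G]: the edges at a vertex [v]
    form a clique of size [d v] in the line graph, and the neighbors of an edge
    [{u, v}] are the other members of the two stars at [u] and [v], which share
    nothing but [{u, v}] itself. So [{u, v}] has degree [d u + d v - 2]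
    ([line_degree]).

    Lower bound: in an alliance [S] an edge [{u, v}] has at most [|S| - 1]
    neighbors, while [d u + d v] is at least the sum of the two smallest degrees
    ([two_smallest_degrees]); hence [2 (|S| - 1) >= d u + d v - 2 + k].

    Upper bound: let [v] be a vertex of maximum degree realizing the minimum
    [delta_star]. Take [m] edges of the star at [v], where [m] is the claimed
    bound; the upper bound on [k] says exactly that the star is large enough.
    Each chosen edge has [m - 1] neighbors in this set, and total degree at most
    [d v + delta_star - 2] because every neighbor of [v] has degree at most
    [delta_star]; the choice of [m] makes this set an alliance
    ([star_alliance]). *)

(** * Alliances in an arbitrary graph *)

Section Alliances.
Variables (H : sgraph) (k : int).
Implicit Types (S : {set H}) (w : H).

Lemma degree_in_setC S w : degree_in S w + degree_in (~: S) w = degree w.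
Proof.
rewrite /degree /degree_in -(cardsID S [set u in [set: H] | adj w u]).
by congr (_ + _); apply: eq_card => u; rewrite !inE // andbC.
Qed.

Lemma degree_in_max S w : w \in S -> degree_in S w < #|S|.
Proof.
move=> wS; rewrite (cardsD1 w S) wS add1n ltnS; apply: subset_leq_card.
apply/subsetP=> u; rewrite !inE => /andP[-> adj_wu]; rewrite andbT.
by apply: contraTneq adj_wu => ->; rewrite adj_irr.
Qed.

Lemma degree_in_clique S w :
  {in S &, forall u v, u != v -> adj u v} -> w \in S ->
  (degree_in S w).+1 = #|S|.
Proof.
move=> cliqueS wS; rewrite (cardsD1 w S) wS add1n; congr _.+1.
apply: eq_card => u; rewrite !inE; case uS: (u \in S); last by rewrite andbF.
rewrite andbT; case: eqVneq => [-> | uw]; first by rewrite adj_irr.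
by rewrite cliqueS // eq_sym.
Qed.

Lemma defensive_allianceP S :
  reflect (S != set0 /\
           {in S, forall w, ((degree w)%:Z + k <= (degree_in S w).*2%:Z)%R})
          (defensive_alliance k S).
Proof.
apply: (iffP andP) => -[S0 def]; split=> //.
  by move=> w wS; move/forall_inP: def => /(_ w wS); rewrite -(degree_in_setC S w); lia.
by apply/forall_inP=> w wS; move: (def w wS); rewrite -(degree_in_setC S w); lia.
Qed.

End Alliances.

(** * Stars of a graph inside its line graph *)

Section Stars.
Variable G : sgraph.
Implicit Types (u v : G) (e f : line_vertex G).

Definition star v : {set line_vertex G} := [set e : line_vertex G | v \in val e].

Lemma adj_neq u v : adj u v -> u != v.
Proof. by apply: contraTneq => ->; rewrite adj_irr. Qed.

Lemma edgesP (A : {set G}) :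
  reflect (exists u v, adj u v /\ A = [set u; v]) (A \in edges G).
Proof.
apply: (iffP imsetP) => [[[u v]] | [u [v [uv ->]]]].
  by rewrite inE /= => uv ->; exists u, v.
by exists (u, v); rewrite ?inE.
Qed.

Lemma set2_injr u : injective (fun v : G => [set u; v]).
Proof.
move=> v w /setP eq_vw.
move: (eq_vw v) (eq_vw w); rewrite !inE !eqxx !orbT.
by case: (eqVneq v u) => [-> _ | _ /esym/eqP //]; case: (eqVneq w u) => [-> | _ /eqP].
Qed.

Lemma star_edgeP v e :
  v \in val e -> exists2 w, adj v w & val e = [set v; w].
Proof.
case/edgesP: (valP e) => x [y [xy ->]]; rewrite !inE => /orP[] /eqP->.
  by exists y.
by exists x; rewrite 1?adj_sym // setUC.
Qed.

Lemma card_star v : #|star v| = degree v.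
Proof.
rewrite -(card_imset _ val_inj) /degree /degree_in.
rewrite -(card_imset _ (@set2_injr v)); congr #|pred_of_set _|; apply/setP=> A.
apply/imsetP/imsetP => [[e] | [w]]; rewrite !inE.
  by move=> /star_edgeP[w vw eE] ->; exists w => //; rewrite !inE.
move=> /= vw ->.
have edge_vw : [set v; w] \in edges G by apply/edgesP; exists v, w.
by exists (exist (fun A => A \in edges G) _ edge_vw); rewrite // !inE eqxx.
Qed.

(** In a simple graph an edge is determined by its endpoints. *)
Lemma starI u v e : u != v -> val e = [set u; v] -> star u :&: star v = [set e].
Proof.
move=> uv eE; apply/setP=> f; rewrite !inE.
apply/andP/eqP => [[/star_edgeP[w _ fE]] | ->]; last by rewrite eE set21 set22.
rewrite fE !inE eq_sym (negPf uv) /= => /eqP vw.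
by apply: val_inj; rewrite fE eE vw.
Qed.

(** The neighbors of [{u, v}] are the members of [star u :|: star v] other than
    [{u, v}] itself, and [{u, v}] is counted in both stars. *)
Lemma line_degree u v (e : line_graph G) : adj u v -> val e = [set u; v] ->
  (@degree (line_graph G) e).+2 = degree u + degree v.
Proof.
move=> uv eE; have e_stars : e \in star u :|: star v by rewrite !inE eE set21.
rewrite -!card_star -cardsUI (starI (adj_neq uv) eE) cards1 addn1.
rewrite (cardsD1 e) e_stars add1n; congr _.+2.
apply: eq_card => f; rewrite !inE /= /line_adj eq_sym; congr andb.
apply/set0Pn/orP => [[x] | ].
  by rewrite eE !inE => /andP[/orP[] /eqP->]; [left | right].
by case=> fx; [exists u | exists v]; rewrite inE fx eE !inE eqxx ?orbT.
Qed.

(** Any two edges at [v] meet in [v]. *)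
Lemma star_clique v (S : {set line_graph G}) :
  S \subset star v -> {in S &, forall e f : line_graph G, e != f -> adj e f}.
Proof.
move=> /subsetP Sv e f /Sv eS /Sv fS ef; rewrite /= /line_adj ef /=.
by apply/set0Pn; exists v; move: eS fS; rewrite !inE => -> ->.
Qed.

End Stars.

(** * Extremal vertices of the degree sequence *)

Section DegreeSequence.
Variable G : sgraph.
Implicit Types (u v : G).

Lemma max_degree_attained : 0 < #|G| -> exists v : G, degree v = delta G 1.
Proof.
move=> G0; have /mapP[v _ vE] : delta G 1 \in [seq degree v | v <- enum G].
  by rewrite -(mem_sort geq) mem_nth // size_sort size_map -cardE.
by exists v.
Qed.

Lemma delta_star_attained : 0 < #|G| ->
  exists2 v : G, degree v = delta G 1 & max_nbr_degree v <= delta_star G.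
Proof.
case/max_degree_attained=> v0 /eqP v0P.
have [v /eqP vP minv] :=
  arg_minnP (P := fun v : G => degree v == delta G 1) (@max_nbr_degree G) v0P.
exists v => //; rewrite /delta_star; elim/big_ind: _ => //.
  (* The neutral element [#|G|] of the minimum bounds [max_nbr_degree v]. *)
  by apply/bigmax_leqP=> u _; apply: max_card.
by move=> m n vm vn; rewrite leq_min vm.
Qed.

(** Sorting the vertices themselves by decreasing degree sorts the degrees, and
    places [u] and [v] at distinct positions: the earlier of the two is at most
    the last but one. *)
Lemma two_smallest_degrees u v : u != v ->
  delta G #|G| + delta G #|G|.-1 <= degree u + degree v.
Proof.
move=> uv; pose r := relpre (@degree G) geq; pose s := sort r (enum G).
have seqE : degree_seq G = [seq degree w | w <- s] by rewrite /degree_seq sort_map.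
have mem_s w : w \in s by rewrite mem_sort mem_enum.
have size_s : size s = #|G| by rewrite size_sort -cardE.
have geq_tr : transitive geq by move=> a b c ba cb; apply: leq_trans cb ba.
have sorted_seq : sorted geq (degree_seq G).
  by apply: sort_sorted => a b; apply: leq_total.
have delta_le i w : index w s < i <= #|G| -> delta G i <= degree w.
  move=> /andP[wi iG]; have ws : index w s < size s by rewrite index_mem.
  rewrite -[X in degree X](nth_index w (mem_s w)) -(nth_map w 0) // -seqE.
  have size_seq : size (degree_seq G) = #|G| by rewrite seqE size_map.
  apply: (sorted_leq_nth geq_tr leqnn 0 sorted_seq); rewrite ?inE ?size_seq; lia.
wlog ltuv : u v uv / index u s < index v s => [main | ].
  have [lt_uv | lt_vu | eq_ind] := ltngtP (index u s) (index v s).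
  - exact: main.
  - by rewrite (addnC (degree u)); apply: main; rewrite // eq_sym.
  - by case/eqP: uv; rewrite -(nth_index u (mem_s u)) eq_ind nth_index.
have vG : index v s < #|G| by rewrite -size_s index_mem.
rewrite addnC; apply: leq_add; apply: delta_le; lia.
Qed.

End DegreeSequence.

(** * The two bounds *)

Local Open Scope ring_scope.

(** These bounds pin the ceiling down and let [lia] do all later rounding. *)
Lemma ceil_half_bounds (z : int) :
  z <= 2 * Num.ceil (z%:~R / 2 : rat) <= z + 1.
Proof.
have /andP[lt_c le_c] := ceil_itv (z%:~R / 2 : rat); set c := Num.ceil _ in lt_c le_c *.
have le_z : z%:~R <= (2 * c)%:~R :> rat by rewrite intrM; lra.
have lt_z : (2 * (c - 1))%:~R < z%:~R :> rat by rewrite intrM; lra.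
by move: le_z lt_z; rewrite ler_int ltr_int; lia.
Qed.

(** Each edge of [S] has [#|S| - 1] neighbors inside [S], and its degree is at
    most [degree v + max_nbr_degree v - 2]. *)
Lemma star_alliance (G : sgraph) (v : G) (k : int) (S : {set line_graph G}) :
  S \subset star v -> S != set0 ->
  (degree v)%:Z + (max_nbr_degree v)%:Z + k <= #|S|.*2%:Z ->
  defensive_alliance k S.
Proof.
move=> Sv S0 leS; apply/defensive_allianceP; split=> // e eS.
have : e \in star v by apply: (subsetP Sv).
rewrite inE => /star_edgeP[w vw eE].
have := line_degree vw eE; have := degree_in_clique (star_clique Sv) eS.
have : (degree w <= max_nbr_degree v)%N by apply: leq_bigmax_cond.
lia.
Qed.

Lemma alliance_card_ge (G : sgraph) (k : int) (S : {set line_graph G}) :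
  defensive_alliance k S ->
  (delta G #|G|)%:Z + (delta G #|G|.-1)%:Z + k <= #|S|.*2%:Z.
Proof.
case/defensive_allianceP=> /set0Pn[e eS] /(_ e eS) le_e.
have [u [v [uv eE]]] := edgesP _ (valP e).
have := line_degree uv eE; have := two_smallest_degrees (adj_neq uv).
have := degree_in_max eS; lia.
Qed.

Theorem theorem10 (G : sgraph) (hE : exists u v : G, adj u v) :
  (forall k : int,
     2 - (delta_star G)%:Z - (delta G 1)%:Z <= k ->
     k <= (delta G 1)%:Z - (delta_star G)%:Z ->
     (exists S : {set line_graph G}, defensive_alliance k S) ->
     (alliance_number (line_graph G) k)%:Z
       <= Num.ceil (((delta G 1)%:Z + (delta_star G)%:Z + k)%:~R / 2 : rat))
  /\
  (forall k : int,
     2 - (delta G 1)%:Z - (delta G 2)%:Z <= k ->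
     k <= (delta G 1)%:Z + (delta G 2)%:Z - 2 ->
     (exists S : {set line_graph G}, defensive_alliance k S) ->
     Num.ceil (((delta G #|G|)%:Z + (delta G #|G|.-1)%:Z + k)%:~R / 2 : rat)
       <= (alliance_number (line_graph G) k)%:Z).
Proof.
split=> k k_ge k_le exS; last first.
  have [S dS ->] := alliance_number_attained exS.
  have := alliance_card_ge dS.
  by have := ceil_half_bounds ((delta G #|G|)%:Z + (delta G #|G|.-1)%:Z + k); lia.
have [v dv nbr_v] : exists2 v : G, degree v = delta G 1 &
    (max_nbr_degree v <= delta_star G)%N.
  by have [u _] := hE; apply/delta_star_attained/card_gt0P; exists u.
have := ceil_half_bounds ((delta G 1)%:Z + (delta_star G)%:Z + k).
set c := Num.ceil _ => c_bounds.
(* The lower bound on [k] gives [1 <= c], the upper one [c <= #|star v|]. *)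
have [m cE] : exists m : nat, c = m.+1%:Z by exists `|c - 1|%N; lia.
have /card_geqP[s [uniq_s size_s s_star]] : (m < #|star v|)%N.
  by rewrite card_star dv; lia.
have card_s : #|[set e in s]| = m.+1 by rewrite cardsE (card_uniqP uniq_s).
rewrite cE lez_nat -card_s; apply: alliance_number_le.
apply: (star_alliance (v := v)).
- by apply/subsetP=> e; rewrite inE => /s_star.
- by rewrite -card_gt0 card_s.
- by rewrite card_s dv; lia.
Qed.
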